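(* Let $X$ be a completely regular space. Let $H$ be a non-vanishing closed ideal in $C_B(X)$. The following are equivalent: (1) Components of $\mathfrak{sp}(H)$ are open in $\mathfrak{sp}(H)$; in particular, $\mathfrak{sp}(H)$ is locally connected. (2) There is a representation $$H=\overline{\bigoplus_{i\in I}H_i},$$ where $H_i$ is an indecomposable closed ideal in $C_B(X)$ for any $i\in I$. Here the bar denotes the closure in $C_B(X)$.
   Context: Completely regular spaces are assumed to be Hausdorff. $C_B(X)$ is the normed algebra of continuous bounded mappings $f:X\to\mathbb{C}$ with the supremum norm. An ideal $H$ of $C_B(X)$ is non-vanishing if for every $x\in X$ there is some $h\in H$ with $h(x)\neq0$. For a non-vanishing closed ideal $H$ of $C_B(X)$, $\mathfrak{sp}(H)$ denotes the spectrum of $H$ (as a $C^*$-subalgebra of $C_B(X)$); it is identified with the subspace $\bigcup_{h\in H}\mathrm{cl}_{\beta X}|h|^{-1}((1,\infty))$ of the Stone–Čech compactification $\beta X$ of $X$, where $\mathrm{cl}_{\beta X}$ denotes closure in $\beta X$. For a collection $\{H_i:i\in I\}$ of ideals of $C_B(X)$, $\bigoplus_{i\in I}H_i$ denotes the ideal $\langle\bigcup_{i\in I}H_i\rangle$ generated by $\bigcup_{i\in I}H_i$, provided that $H_i\cap\langle\bigcup_{j\in I,\,j\neq i}H_j\rangle=\{\mathbf{0}\}$ for each $i\in I$. An ideal $K$ of $C_B(X)$ is indecomposable if $K\neq M\oplus N$ for any non-zero ideals $M$ and $N$ of $C_B(X)$.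
   Formalization: The clause ''in particular, sp(H) is locally connected'' is dropped from (1): it is false, e.g. for H = C(X) with X the closed topologist's sine curve, where (2) holds and the only component is open, yet sp(H) = X is not locally connected. *)

(* Defs.v *)
From HB Require Import structures.
From mathcomp Require Import all_boot all_order all_algebra.
From mathcomp Require Import complex.
From mathcomp Require Import all_classical all_reals all_analysis.

Set Implicit Arguments.
Unset Strict Implicit.
Unset Printing Implicit Defensive.

Import Order.TTheory GRing.Theory Num.Theory.
Import numFieldNormedType.Exports.

Local Open Scope classical_set_scope.
Local Open Scope ring_scope.
Local Open Scope complex_scope.

Section BoundedContinuous.
Context (R : realType) (X : topologicalType).
(* The topology on R[i] is the one of its modulus; the library attaches it to
   the alias (R[i])^o. *)
Local Notation C := ((R[i])^o).

Definition bcont : {pred X -> C} :=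
  mem [set f : X -> C | continuous f /\ bounded_fun f].

Record CB := MkCB { CB_val :> X -> C; CB_valP : CB_val \in bcont }.

HB.instance Definition _ := [isSub for CB_val].
HB.instance Definition _ := [Choice of CB by <:].

Lemma bcontP (f : X -> C) : reflect
  (continuous f /\ exists M : R, forall x, `|f x| <= M%:C) (f \in bcont).
Proof.
apply: (iffP idP) => [/set_mem[cf [M [Mreal fM]]]|[cf [M fM]]].
  split=> //; exists (complex.Re (M + 1)) => x.
  have MM : M < M + 1 by rewrite ltrDl.
  apply: le_trans (fM _ MM x I) _.
  by rewrite RRe_real// realD// ?real1.
apply/mem_set; split=> //; exists M%:C; split; first by apply/complex_realP; exists M.
by move=> N MN x _ /=; exact: le_trans (fM x) (ltW MN).
Qed.

Lemma bcont_submod_closed : submod_closed bcont.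
Proof.
split=> [|a f g /bcontP[cf [M fM]] /bcontP[cg [N gN]]]; apply/bcontP.
  by split; [exact: cst_continuous|exists 0 => x; rewrite normr0].
split.
  move=> x; apply: cvgD; last exact: cg.
  by apply: cvgZr; exact: cf.
exists (complex.Re `|a| * M + N) => x.
rewrite rmorphD rmorphM/= (RRe_real (normr_real a)).
rewrite (le_trans (ler_normD _ _))// lerD//.
by rewrite normrM ler_wpM2l.
Qed.

Lemma bcont_subring_closed : subring_closed bcont.
Proof.
have [_ bZ] := bcont_submod_closed.
split=> [|f g bf bg|f g /bcontP[cf [M fM]] /bcontP[cg [N gN]]].
- apply/bcontP; split; first exact: cst_continuous.
  by exists 1 => x; rewrite normr1.
- by rewrite addrC -scaleN1r bZ.
- apply/bcontP; split; first by move=> x; apply: cvgM; [exact: cf|exact: cg].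
  by exists (M * N) => x; rewrite rmorphM normrM ler_pM.
Qed.

HB.instance Definition _ := GRing.isSubmodClosed.Build _ _ bcont
  bcont_submod_closed.
HB.instance Definition _ := GRing.isSubringClosed.Build _ bcont
  bcont_subring_closed.
HB.instance Definition _ := GRing.SubChoice_isSubComPzRing.Build _ _ CB
  (subringClosedP _).
HB.instance Definition _ := [SubZmodule_isSubLmodule of CB by <:].

Lemma CB_ext (f g : CB) : f =1 g -> f = g.
Proof. by move=> fg; apply/val_inj/funext. Qed.

(* The norm of a module over R[i] takes values in R[i]; for empty X the
   supremum is 0. *)
Definition supnorm (f : CB) : R[i] :=
  (sup (range (fun x => complex.Re `|f x|)))%:C.

Lemma supnormP (f : CB) x : `|f x| <= supnorm f.
Proof.
rewrite -[leLHS]RRe_real ?normr_real// lecR.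
apply: ub_le_sup; last by exists x.
have /bcontP[_ [M fM]] := CB_valP f.
by exists M => _ [y _ <-]; rewrite -lecR RRe_real ?normr_real.
Qed.

Lemma supnorm_le (f : CB) (M : R[i]) :
  0 <= M -> (forall x, `|f x| <= M) -> supnorm f <= M.
Proof.
move=> M0 fM; have MR := ger0_real M0.
rewrite -(RRe_real MR) lecR.
have [->|/set0P ne] := eqVneq (range (fun x => complex.Re `|f x|)) set0.
  by rewrite sup0 -lecR RRe_real.
apply: ge_sup => // _ [x _ <-].
by rewrite -lecR !RRe_real ?normr_real.
Qed.

Lemma supnorm_ge0 (f : CB) : 0 <= supnorm f.
Proof.
have [[x _]|X0] := pselect (exists x : X, True).
  exact: le_trans (normr_ge0 _) (supnormP f x).
rewrite /supnorm (_ : [set _ | _ in _] = set0) ?sup0//.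
by apply/seteqP; split=> // y [x _ _]; apply: X0; exists x.
Qed.

Lemma supnormD (f g : CB) : supnorm (f + g) <= supnorm f + supnorm g.
Proof.
apply: supnorm_le => [|x]; first by rewrite addr_ge0 ?supnorm_ge0.
by rewrite (le_trans (ler_normD _ _))// lerD ?supnormP.
Qed.

Lemma supnormZ (a : R[i]) (f : CB) : supnorm (a *: f) = `|a| * supnorm f.
Proof.
have le b g : supnorm (b *: g) <= `|b| * supnorm g.
  apply: supnorm_le => [|x]; first by rewrite mulr_ge0 ?supnorm_ge0.
  by rewrite normrM ler_wpM2l ?supnormP.
apply/le_anti; rewrite le/=; have [->|a0] := eqVneq a 0.
  by rewrite normr0 mul0r supnorm_ge0.
rewrite -ler_pdivlMl ?normr_gt0// -normfV.
by rewrite -[in leLHS](scalerK a0 f).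
Qed.

Lemma supnorm_eq0 (f : CB) : supnorm f = 0 -> f = 0.
Proof.
move=> f0; apply: CB_ext => x; apply/eqP.
by rewrite -normr_le0 -f0 supnormP.
Qed.

HB.instance Definition _ :=
  Lmodule_isNormed.Build R[i] CB supnormD supnormZ supnorm_eq0.

End BoundedContinuous.

Section Ideals.
Context (A : comPzRingType).

(* In CB R X, which contains the constants, ring ideals are also closed under
   complex scaling, so they are the algebra ideals. *)
Definition ideal (K : set A) : Prop :=
  [/\ K 0, forall f g, K f -> K g -> K (f + g)
    & forall f g, K g -> K (f * g)].

Definition ideal_gen (B : set A) : set A := smallest ideal B.

(* The internal direct sum of a family K is dsum K, and it is only defined when
   K is independent; [M (+) N] is the case of a family indexed by bool. *)
Definition dsum (I : Type) (K : I -> set A) : set A :=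
  ideal_gen (\bigcup_i K i).

Definition independent (I : Type) (K : I -> set A) : Prop :=
  forall i, K i `&` ideal_gen (\bigcup_(j in [set j | j <> i]) K j) = [set 0].

Definition indecomposable (K : set A) : Prop :=
  forall M N : set A, ideal M -> ideal N -> M <> [set 0] -> N <> [set 0] ->
  let MN := fun b : bool => if b then M else N in
  ~ (independent MN /\ K = dsum MN).

End Ideals.

(* [stone_cech e]: the Hausdorff compactification e : X -> bX is the
   Stone-Cech compactification of X, through its universal property (which
   determines it up to a homeomorphism under X). *)
Definition stone_cech (X bX : topologicalType) (e : X -> bX) : Prop :=
  [/\ compact [set: bX], hausdorff_space bX,
      [/\ injective e, continuous e
        & forall U, open U -> exists2 V, open V & e @^-1` V = U],
      dense (range e)
    & forall (K : topologicalType) (g : X -> K),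
        compact [set: K] -> hausdorff_space K -> continuous g ->
        exists2 G : bX -> K, continuous G & G \o e = g].

Definition non_vanishing (R : realType) (X : topologicalType)
    (H : set (CB R X)) : Prop :=
  forall x, exists2 h, H h & h x <> 0.

(* The spectrum of H, identified with the subspace of bX formed by the union of
   the closures of the sets |h|^{-1}((1,oo)), h in H. *)
Definition sp (R : realType) (X bX : topologicalType) (e : X -> bX)
    (H : set (CB R X)) : set bX :=
  \bigcup_(h in H) closure (e @` [set x | 1 < `|h x|]).

(* Main.v *)
Require Import Defs.
From mathcomp Require Import all_boot all_order all_algebra.
From mathcomp Require Import complex.
From mathcomp Require Import all_classical all_reals all_analysis.
Set Implicit Arguments.
Unset Strict Implicit.
Unset Printing Implicit Defensive.
Import Order.TTheory GRing.Theory Num.Theory.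
Import numFieldNormedType.Exports.
Local Open Scope classical_set_scope.
Local Open Scope ring_scope.
Import ComplexField.Normc.

(* A bounded continuous function f on X extends to bX, and an ideal J has a
   cozero set coz J, the open set of points of bX where some extension of an
   element of J does not vanish; sp(H) is coz H.  By compactness of bX, a closed
   ideal is van (coz J), the functions whose extension vanishes off coz J, and
   by Urysohn's lemma coz (van U) = U for U open, so closed ideals of C_B(X) and
   open sets of bX correspond to each other.  Independent ideals have disjoint
   cozero sets, and coz turns closures of sums into unions.  A closed ideal is
   indecomposable iff its cozero set is connected: a function vanishing off
   the disjoint union of two open sets can be truncated to either of them.
   Hence a decomposition of H as in (2) amounts to a partition of sp(H) into
   connected open sets, which are then its components. *)

(** * Compactness and separation for a set regarded as a space of its own *)

Lemma compact_set_type (T : topologicalType) (A : set T) :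
  compact A -> compact [set: A].
Proof.
move=> cA F PF _.
have [|p [Ap clp]] := cA (set_val @ F) _.
  rewrite nbhs_simpl/=; apply: (@filterS _ F _ setT) filterT => x _.
  exact: set_valP.
exists (exist _ p (mem_set Ap)); split => // B U FB [_ [[W oW <-] Wp WU]].
have [q [[b Bb <-] Wb]] : set_val @` B `&` W !=set0.
  apply: clp; last exact: open_nbhs_nbhs.
  by rewrite nbhs_simpl/=; apply: (@filterS _ F _ B) FB => b Bb; exists b.
by exists b; split=> //; exact: WU.
Qed.

Lemma hausdorff_set_type (T : topologicalType) (A : set T) :
  hausdorff_space T -> hausdorff_space A.
Proof.
move=> hT p q clpq; apply/val_inj/hT => U V Up Vq.
have [r [Ur Vr]] := clpq _ _ (@initial_continuous _ _ _ _ _ Up)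
  (@initial_continuous _ _ _ _ _ Vq).
by exists (val r).
Qed.

(** * Topology of the complex plane: real-valued modulus, conjugation, compact squares *)

Section ComplexTopology.
Context (R : realType).
Local Notation C := ((R[i])^o).

Lemma normc_real (x : R) : normc (x%:C)%C = `|x|.
Proof. by rewrite /= expr0n/= addr0 sqrtr_sqr. Qed.

Lemma normr_normc (z : R[i]) : `|z| = ((normc z)%:C)%C.
Proof. by []. Qed.

Lemma continuous_real_complex : continuous (fun x : R => (x%:C)%C : C).
Proof.
move=> x; apply/cvgrPdist_lt => eps eps0.
(* A positive element of [R[i]] is real, so [eps] can be traded for its real part. *)
have epsE := RRe_real (gtr0_real eps0).
have {}eps0 : 0 < complex.Re eps by rewrite -ltcR epsE.
near=> y.
rewrite -epsE -rmorphB/= normr_normc normc_real ltcR.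
near: y; exact: cvgr_dist_lt.
Unshelve. all: by end_near. Qed.

Lemma continuous_conjc : continuous (@conjc R : C -> C).
Proof.
move=> x.
apply/(@cvgrPdist_lt _ C C _ (nbhs_filter (x : C)) (@conjc R)) => eps eps0.
have : \forall y \near x, `|x - y| < eps.
  by exact: (@cvgr_dist_lt _ C C (nbhs (x : C)) _ id x cvg_id).
by apply: filterS => y; rewrite -rmorphB/= normcJ.
Qed.

Lemma continuous_normc : continuous (@normc R : C -> R).
Proof.
move=> x.
apply/(@cvgrPdist_lt _ R C _ (nbhs_filter (x : C)) (@normc R)) => eps eps0.
have epsC : 0 < (eps%:C)%C by rewrite ltcR.
have : \forall y \near x, `|x - y| < (eps%:C)%C.
  by exact: (@cvgr_dist_lt _ C C (nbhs (x : C)) _ id x cvg_id).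
apply: filterS => y /=; rewrite normr_normc ltcR; apply: le_lt_trans.
rewrite -lecR; have := @ler_dist_dist _ C x y.
by rewrite !normr_normc -rmorphB normc_real.
Qed.

(** A compact target for the universal property of [bX]; writing it as a continuous image of a
    product of two segments makes compactness immediate. *)
Definition square (M : R) : set C :=
  (fun ab : R * R => (ab.1%:C)%C + 'i%C * (ab.2%:C)%C) @`
    (`[- M, M] `*` `[- M, M]).

Lemma compact_square M : compact (square M).
Proof.
apply: continuous_compact; last first.
  by apply: compact_setX; exact: segment_compact.
apply: continuous_subspaceT => ab; apply: cvgD.
  by apply: continuous_comp; [exact: cvg_fst|exact: continuous_real_complex].
apply: cvgM; first exact: cvg_cst.
by apply: continuous_comp; [exact: cvg_snd|exact: continuous_real_complex].
Qed.

Lemma norm_le_square M (z : C) : `|z| <= (M%:C)%C -> square M z.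
Proof.
move=> zM; exists (complex.Re z, complex.Im z); last by rewrite /= -complexE.
have lec (x : R) : (`|x|%:C <= `|z|)%C -> x \in `[- M, M].
  by move=> /le_trans/(_ zM); rewrite lecR ler_norml in_itv.
split; apply: lec; first exact: normc_ge_Re.
(* The imaginary part is bounded through the real one: Re(iz) = -Im z and |iz| = |z|. *)
have := normc_ge_Re (z * 'i%C).
rewrite ReiNIm normrN normrM (normc_def 'i%C)/= expr0n expr1n add0r.
by rewrite sqrtr1 mulr1.
Qed.

End ComplexTopology.

(** * Extension of bounded continuous functions to [bX] *)

Section StoneCech.
Context (R : realType) (X bX : topologicalType) (e : X -> bX).
Context (sc : stone_cech e).
Local Notation C := ((R[i])^o).
Implicit Types (f g h : CB R X) (G : bX -> C) (p : bX).

(** Boundedness puts the values of [f] in a compact square, to which the universal property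
    applies. *)
Lemma ext_exists f : exists G : bX -> C, continuous G /\ G \o e = f.
Proof.
have [_ _ _ _ univ] := sc.
have /bcontP[cf [M fM]] := CB_valP f.
pose g x : square M := exist _ (f x) (mem_set (norm_le_square (fM x))).
have [|||G cG Gg] := univ _ g.
- exact/compact_set_type/compact_square.
- exact/hausdorff_set_type/norm_hausdorff.
- by apply: continuous_comp_initial => x; exact: cf.
exists (set_val \o G); split; last by rewrite -compA Gg.
by move=> p; apply: continuous_comp; [exact: cG|exact: initial_continuous].
Qed.

Definition ext f : bX -> C := projT1 (cid (ext_exists f)).

Lemma continuous_ext f : continuous (ext f).
Proof. by rewrite /ext; case: cid => G []. Qed.

Lemma extE f x : ext f (e x) = f x.
Proof. by rewrite /ext; case: cid => G [/= _ Gf]; rewrite -Gf. Qed.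

(** Carries closed conditions, such as an equality or a bound on the modulus, from [X] to [bX] by
    density. *)
Lemma dense_closed (B : set bX) : closed B -> (forall x, B (e x)) -> B = setT.
Proof.
have [_ _ _ dX _] := sc => cB eB; apply/seteqP; split=> // p _.
apply: contrapT => nBp.
have [|q [nB [x _ exq]]] := dX (~` B) _ (closed_openC cB); first by exists p.
by apply: nB; rewrite -exq.
Qed.

Lemma ext_unique f G : continuous G -> (forall x, G (e x) = f x) -> ext f = G.
Proof.
move=> cG Gf; apply/funext => p; apply/subr0_eq.
suff /seteqP[_ /(_ p I)] : (ext f \- G) @^-1` [set 0 : C] = setT by [].
apply: dense_closed => [|x /=]; last by rewrite /= extE Gf subrr.
apply: closed_comp => [q _|].
  by apply: cvgB; [exact: continuous_ext|exact: cG].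
exact/accessible_closed_set1/hausdorff_accessible/norm_hausdorff.
Qed.

Lemma ext0 : ext 0 = cst 0.
Proof. by apply: ext_unique => //; exact: cst_continuous. Qed.

Lemma extD f g : ext (f + g) = ext f \+ ext g.
Proof.
apply: ext_unique => [q|x]; last by rewrite /= !extE.
by apply: cvgD; exact: continuous_ext.
Qed.

Lemma extM f g : ext (f * g) = ext f \* ext g.
Proof.
apply: ext_unique => [q|x]; last by rewrite /= !extE.
by apply: cvgM; exact: continuous_ext.
Qed.

Lemma extB f g : ext (f - g) = ext f \- ext g.
Proof.
apply: ext_unique => [q|x]; last by rewrite /= !extE.
by apply: cvgB; exact: continuous_ext.
Qed.

Lemma ext_inj f g : ext f = ext g -> f = g.
Proof. by move=> fg; apply: CB_ext => x; rewrite -!extE fg. Qed.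

Lemma normc_ext_le f (M : R) :
  (forall x, normc (f x) <= M) -> forall p, normc (ext f p) <= M.
Proof.
move=> fM p.
suff /seteqP[_ /(_ p I)] : (@normc R \o ext f) @^-1` [set t | t <= M] = setT.
  by [].
apply: dense_closed => [|x /=]; last by rewrite extE.
apply: closed_comp; last exact: closed_le.
by move=> q _; apply: continuous_comp;
  [exact: continuous_ext|exact: continuous_normc].
Qed.

(** Compactness of [bX] bounds [G]. Elements of ideals may thus be multiplied by any continuous
    function on [bX]. *)
Lemma ext_surj G : continuous G -> exists f, ext f = G.
Proof.
have [cX _ [_ ce _] _ _] := sc => cG.
suff Gb : (G \o e : X -> C) \in @bcont R X.
  by exists (MkCB Gb); exact: ext_unique.
apply/bcontP; split.
  by move=> x; apply: continuous_comp; [exact: ce|exact: cG].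
have : compact ((@normc R \o G) @` setT).
  apply: continuous_compact cX; apply: continuous_subspaceT => p.
  by apply: continuous_comp; [exact: cG|exact: continuous_normc].
move=> /compact_bounded[M [_ MG]]; exists (M + 1) => x.
rewrite normr_normc lecR (le_trans (ler_norm _))// MG ?ltrDl//.
Qed.

(** A bound on [X] is the same as a bound on [bX], so closure in the supremum norm is uniform
    approximation of the extensions. *)
Lemma closure_ext (J : set (CB R X)) f : closure J f <->
  forall eps : R, 0 < eps ->
    exists2 g, J g & forall p, normc (ext f p - ext g p) <= eps.
Proof.
split=> [clf eps eps0|clf B /nbhs_ballP[eps/= eps0 fB]].
  have epsC : 0 < (eps%:C)%C by rewrite ltcR.
  have [g [Jg fg]] := clf _ (nbhsx_ballx f _ epsC).
  exists g => // p; move: p.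
  have: forall x, normc ((f - g) x) <= eps.
    move=> x; rewrite -lecR -normr_normc (le_trans (supnormP _ _))//.
    by move: fg; rewrite -ball_normE/= => /ltW.
  by move=> /normc_ext_le fgle p; have := fgle p; rewrite extB.
have epsE := RRe_real (gtr0_real eps0).
(* The approximation gives a non-strict bound while balls are open, hence the half. *)
have eps2 : 0 < complex.Re eps / 2 by rewrite divr_gt0// -ltcR epsE.
have [g Jg fg] := clf _ eps2; exists g; split=> //; apply: fB.
rewrite -ball_normE/=; apply: (@le_lt_trans _ _ ((complex.Re eps / 2)%:C)%C).
  apply: supnorm_le => [|x]; first by rewrite lecR ltW.
  by rewrite normr_normc lecR -!extE extB fg.
by rewrite -[ltRHS]epsE ltcR ltr_pdivrMr// ltr_pMr ?ltr1n// -ltcR epsE.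
Qed.

End StoneCech.

(** * Generated ideals *)

Section IdealGen.
Context (A : comPzRingType).
Implicit Types (B J : set A).

Lemma ideal_ideal_gen B : ideal (ideal_gen B).
Proof.
split=> [J [[]]|f g Jf Jg J|f g Jg J] //.
  by move=> JB; have [[_ JD _] _] := JB; apply: JD; [exact: Jf|exact: Jg].
by move=> JB; have [[_ _ JM] _] := JB; apply: JM; exact: Jg.
Qed.

Lemma ideal_gen_min B J : ideal J -> B `<=` J -> ideal_gen B `<=` J.
Proof. exact: smallest_sub. Qed.

Lemma sub_dsum (I : Type) (K : I -> set A) i : K i `<=` dsum K.
Proof. by move=> f Kf; apply: sub_gen_smallest; exists i. Qed.

End IdealGen.

(** * Cozero sets of ideals and ideals of functions vanishing off a set *)

Section ClosedIdeals.
Context (R : realType) (X bX : topologicalType) (e : X -> bX).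
Context (sc : stone_cech e).
Local Notation C := ((R[i])^o).
Local Notation ext := (@ext R X bX e sc).
Implicit Types (f g h : CB R X) (J : set (CB R X)) (U V B : set bX).

Definition coz J : set bX := \bigcup_(h in J) [set p | ext h p <> 0].

Definition van U : set (CB R X) := [set f | forall p, ~ U p -> ext f p = 0].

Lemma normc_eq0 (z : R[i]) : (normc z == 0) = (z == 0).
Proof. by apply/eqP/eqP => [/eq0_normc//|->]; rewrite normc0. Qed.

Lemma continuous_normc_ext f : continuous (fun p => normc (ext f p)).
Proof.
by move=> p; apply: continuous_comp;
  [exact: continuous_ext|exact: continuous_normc].
Qed.

Lemma open_coz J : open (coz J).
Proof.
apply: bigcup_open => h _.
rewrite (_ : [set _ | _] = (fun p => normc (ext h p)) @^-1` [set~ 0]).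
  apply: open_comp => [p _|]; first exact: continuous_normc_ext.
  exact/closed_openC/accessible_closed_set1/hausdorff_accessible/Rhausdorff.
by apply/seteqP; split=> p /= hp /eqP; rewrite ?normc_eq0 => /eqP//;
  move=> h0; apply: hp; rewrite h0 normc0.
Qed.

Lemma ext_cst (c : C) : exists f, ext f = cst c.
Proof. by apply: ext_surj; exact: cst_continuous. Qed.

(** In an ideal, [h] can be scaled so that a nonzero value gets modulus above 1. Conversely, [ext h]
    has modulus at least 1 on the closure of the points where |h| > 1. *)
Lemma sp_coz J : ideal J -> sp e J = coz J.
Proof.
move=> [_ _ JM]; apply/seteqP; split=> p [h Jh] hp; last first.
  have h0 : normc (ext h p) != 0 by rewrite normc_eq0; exact/eqP.
  (* This constant gives [k * h] modulus 2 at [p], so [B] below is an open neighbourhood of [p], and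
     density finds points of [X] in it arbitrarily close to [p]. *)
  have [k kE] := ext_cst ((2 / normc (ext h p))%:C)%C.
  exists (k * h); first exact: JM.
  move=> W Wp; have [_ _ _ dX _] := sc.
  pose B := (fun q => normc (ext (k * h) q)) @^-1` [set t | 1 < t].
  have oB : open B.
    apply: open_comp; last exact: open_gt.
    by move=> q _; exact: continuous_normc_ext.
  have [||q [[Wq Bq] [x _ xq]]] := dX (interior W `&` B).
  - exists p; split; first exact: Wp.
    rewrite /B /= extM /= kE normcM normc_real ger0_norm ?divr_ge0 ?sqrtr_ge0//.
      by rewrite divfK// ltr1n.
    by case: (ext h p) => *; exact: sqrtr_ge0.
  - by apply: openI => //; exact: open_interior.
  - exists q; split; last exact: interior_subset.
    exists x => //; rewrite /mkset normr_normc ltcR -(extE sc (k * h)) xq.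
    exact: Bq.
move: hp => /= hp; exists h => //= hp0.
have /hp[q [[x /= hx <-]]] : nbhs p [set q | normc (ext h q) < 1].
  apply: (@continuous_normc_ext h p [set t | t < 1]).
  by rewrite hp0 normc0; exact: lt_nbhsl.
rewrite /= extE => hx1; move: hx.
by rewrite normr_normc ltcR ltNge (ltW hx1).
Qed.

Lemma sub_van_coz J : J `<=` van (coz J).
Proof.
by move=> f Jf p np; apply: contrapT => fp; apply: np; exists f.
Qed.

Lemma coz_sub_van J U : J `<=` van U -> coz J `<=` U.
Proof. by move=> JU p [f /JU fU fp]; apply: contrapT => /fU. Qed.

Lemma cozS J1 J2 : J1 `<=` J2 -> coz J1 `<=` coz J2.
Proof. by move=> JJ p [f /JJ Jf fp]; exists f. Qed.

Lemma vanS U V : U `<=` V -> van U `<=` van V.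
Proof. by move=> UV f fU p nVp; apply: fU => /UV. Qed.

Lemma ideal_van U : ideal (van U).
Proof.
split=> [p _|f g fU gU p nU|f g gU p nU]; first by rewrite ext0.
  by rewrite extD /= fU// gU// addr0.
by rewrite extM /= gU// mulr0.
Qed.

Lemma closed_van U : closed (van U).
Proof.
move=> f /(closure_ext sc) clf p nU; apply: eq0_normc; apply/eqP.
rewrite eq_le; apply/andP; split; last first.
  by case: (ext f p) => *; exact: sqrtr_ge0.
apply/ler_addgt0Pr => eps /clf[g gU /(_ p)].
by rewrite gU// subr0 add0r.
Qed.

(** [bX] is normal, being compact Hausdorff; a Urysohn function that is 0 off [U] and 1 at [p]
    extends an element of [van U]. *)
Lemma coz_van U : open U -> coz (van U) = U.
Proof.
move=> oU; apply/seteqP; split=> [|p Up]; first exact: coz_sub_van.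
have [cX hX _ _ _] := sc.
have /(@uniform_separatorP _ R)[u [cu _ u0 u1]] :
    uniform_separator (~` U) [set p].
  apply: ((@normal_separatorP R _).1 (compact_normal hX cX)).
  - exact: open_closedC.
  - exact/accessible_closed_set1/hausdorff_accessible.
  - by apply/seteqP; split=> // q [+ qp]; rewrite qp.
have [|f fE] := @ext_surj R _ _ _ sc (fun q => (u q)%:C)%C.
  by move=> q; apply: continuous_comp;
    [exact: cu|exact: continuous_real_complex].
exists f => [q nUq|/=].
  by rewrite fE (u0 (u q))//; exists q.
rewrite fE (u1 (u p)); last by exists p.
by apply/eqP; rewrite oner_eq0.
Qed.

(** [van] of the union of the cozero sets is an ideal containing every [K i], hence their sum. *)
Lemma coz_dsum (I : Type) (K : I -> set (CB R X)) :
  coz (dsum K) = \bigcup_i coz (K i).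
Proof.
apply/seteqP; split=> [|p [i _]]; last exact: (cozS (@sub_dsum _ _ K i)).
apply: coz_sub_van.
apply: ideal_gen_min; first exact: ideal_van.
move=> f [i _ Kf]; apply: vanS (sub_van_coz Kf) => p ?; by exists i.
Qed.

Lemma coz_closure J : coz (closure J) = coz J.
Proof.
apply/seteqP; split; last exact/cozS/subset_closure.
apply: coz_sub_van.
rewrite [X in _ `<=` X](closure_id _).1; last exact: closed_van.
exact/closureS/sub_van_coz.
Qed.

Lemma van_disjoint U V : U `&` V = set0 -> van U `&` van V = [set 0].
Proof.
move=> UV0; apply/seteqP; split=> [f [fU fV]|_ ->]; last first.
  by split=> p _; rewrite ext0.
apply: (@ext_inj _ _ _ _ sc); rewrite ext0; apply/funext => p /=.
have [Up|/fU//] := pselect (U p); apply: fV => Vp.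
by have : (U `&` V) p by []; rewrite UV0.
Qed.

Lemma coz_neq0 J : ideal J -> J <> [set 0] -> coz J !=set0.
Proof.
move=> [J0 _ _] Jn0; apply: contrapT => c0; apply: Jn0.
apply/seteqP; split=> [f Jf|_ ->//] /=.
apply: (@ext_inj _ _ _ _ sc); rewrite ext0; apply/funext => p /=.
by apply: (sub_van_coz Jf) => cp; apply: c0; exists p.
Qed.

Lemma van_neq0 U : open U -> U !=set0 -> van U <> [set 0].
Proof.
move=> oU [p Up] v0; have : coz (van U) p by rewrite coz_van.
by rewrite v0 => -[_ ->]; rewrite /= ext0.
Qed.

(** A product of elements of [K i] and [K j] lies in [K i] and in the ideal generated by the other
    members, so it is 0; its two factors cannot both be nonzero at a point. *)
Lemma coz_independent (I : Type) (K : I -> set (CB R X)) i j :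
  (forall i, ideal (K i)) -> independent K -> i <> j ->
  coz (K i) `&` coz (K j) = set0.
Proof.
move=> Ki indK ij; apply/seteqP; split=> // p [[f Kf fp] [g Kg gp]].
have fg0 : f * g = 0.
  suff : [set 0] (f * g) by [].
  rewrite -(indK i); split.
    by have [_ _ KM] := Ki i; rewrite mulrC; exact: KM.
  have [_ _ KM] := ideal_ideal_gen (\bigcup_(j in [set j | j <> i]) K j).
  by apply: KM; apply: sub_gen_smallest; exists j => //= ji; apply: ij.
have /eqP : ext (f * g) p = 0 by rewrite fg0 ext0.
by rewrite extM /= mulf_eq0 => /orP[/eqP|/eqP].
Qed.

End ClosedIdeals.

(** * Recovering a closed ideal from its cozero set; indecomposability and connectedness *)

Section Correspondence.
Context (R : realType) (X bX : topologicalType) (e : X -> bX).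
Context (sc : stone_cech e).
Local Notation C := ((R[i])^o).
Local Notation ext := (@ext R X bX e sc).
Local Notation coz := (@coz R X bX e sc).
Local Notation van := (@van R X bX e sc).
Implicit Types (f g h : CB R X) (J : set (CB R X)) (U V B : set bX).

(** Multiplying [h] by [c] times its conjugate gives c|h|^2, which is nonnegative. The choice of [c]
    makes its value at [p] equal to 2, so it stays above 1 nearby. *)
Lemma ideal_bump J p : ideal J -> coz J p ->
  exists g, [/\ J g, forall q, 0 <= ext g q & \forall q \near p, 1 < ext g q].
Proof.
move=> [_ _ JM] [h Jh /= /eqP hp].
pose c : R[i] := 2 / `|ext h p| ^+ 2.
have c0 : 0 <= c by rewrite divr_ge0 ?exprn_ge0.
have [|k kE] := @ext_surj R _ _ _ sc (fun q => c * (ext h q)^*%C).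
  move=> q; apply: (@cvgM C _ (nbhs q)); first exact: cvg_cst.
  by apply: continuous_comp; [exact: continuous_ext|exact: continuous_conjc].
have gE q : ext (k * h) q = c * `|ext h q| ^+ 2.
  by rewrite extM /= kE -mulrA [_^*%C * _]mulrC -sqr_normc.
have g0 q : 0 <= ext (k * h) q by rewrite gE mulr_ge0 ?exprn_ge0.
exists (k * h); split=> //; first exact: JM.
have gN q : ext (k * h) q = ((normc (ext (k * h) q))%:C)%C.
  by rewrite -normr_normc ger0_norm.
have gp : 1 < normc (ext (k * h) p).
  by rewrite -ltcR -gN gE divfK ?ltr1n// expf_neq0// normr_eq0.
have : \forall q \near p, 1 < normc (ext (k * h) q).
  apply: (@continuous_normc_ext _ _ _ _ sc (k * h) p [set t | 1 < t]).
  exact: lt_nbhsr.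
by apply: filterS => q gq; rewrite gN ltcR.
Qed.

(* The elements of J dominating a given one form a filter base, along which
   compactness is applied as [near_covering] instead of extracting a finite
   subcover. *)
Lemma ideal_compact_bump J (K : set bX) : ideal J -> compact K ->
  K `<=` coz J ->
  exists g, [/\ J g, forall q, 0 <= ext g q & forall q, K q -> 1 < ext g q].
Proof.
move=> iJ /compact_near_coveringP cK KJ; have [J0 JD JM] := iJ.
pose pos := [set h | J h /\ forall q, 0 <= ext h q].
pose up h := [set g | pos g /\ forall q, ext h q <= ext g q].
have FF : Filter (filter_from pos up).
  apply: filter_from_filter; first by exists 0; split=> // q; rewrite ext0.
  (* The sum of two nonnegative elements dominates both. *)
  move=> h1 h2 [J1 p1] [J2 p2]; exists (h1 + h2).
    by split=> [|q]; [exact: JD|rewrite extD addr_ge0].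
  move=> g [pg gq]; split; (split=> // q; apply: le_trans (gq q));
    by rewrite extD /= ?lerDl ?lerDr.
have [q /KJ/(ideal_bump iJ)[g [Jg g0 gq]]|h [Jh h0] hK] :=
    cK _ _ (fun g q => 1 < ext g q) FF.
  exists ([set q' | 1 < ext g q'], up g); first split=> //=.
    by exists g.
  by move=> [q' g'] [/= gq' [_ gg']]; exact: lt_le_trans (gg' q').
by exists h; split=> // q; apply: hK; split.
Qed.

(** With [g] in [J] nonnegative and above 1 where |f| >= eps, the element f g / (g + eta) of [J]
    differs from [f] by f eta / (g + eta), which is uniformly small for small [eta]. *)
Lemma van_coz J : ideal J -> van (coz J) `<=` closure J.
Proof.
move=> iJ f fJ; apply/(closure_ext sc) => eps eps0; have [_ _ JM] := iJ.
have [cX _ _ _ _] := sc.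
pose K := (fun q => normc (ext f q)) @^-1` [set t | eps <= t].
have cK : compact K.
  apply: (subclosed_compact _ cX) => //.
  apply: closed_comp; last exact: closed_ge.
  by move=> q _; exact: continuous_normc_ext.
have KJ : K `<=` coz J.
  move=> q Kq; apply: contrapT => /fJ fq.
  by move: Kq; rewrite /K /= fq normc0 leNgt eps0.
have [g [Jg g0 gK]] := ideal_compact_bump iJ cK KJ.
have /bcontP[_ [M0 fM0]] := CB_valP f.
(* The maximum and the added 1 make the bound positive, so that it can divide [eps]. *)
pose M := Num.max M0 0 + 1.
have M_gt0 : 0 < M by rewrite ltr_pwDr// le_max lexx orbT.
have fM q : normc (ext f q) <= M.
  apply: (normc_ext_le sc) => x.
  rewrite -lecR -normr_normc (le_trans (fM0 x))//.
  by rewrite lecR ler_wpDr// le_max lexx.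
pose eta := eps / M.
have eta0 : 0 < eta by rewrite divr_gt0.
pose t q := complex.Re (ext g q).
have gE q : ext g q = ((t q)%:C)%C by rewrite RRe_real// ger0_real.
have t0 q : 0 <= t q by rewrite -lecR -gE.
have te0 q : 0 < t q + eta by rewrite ltr_wpDl.
have geE q : ext g q + (eta%:C)%C = ((t q + eta)%:C)%C by rewrite gE rmorphD.
have ge0 q : ext g q + (eta%:C)%C != 0.
  by rewrite geE -[0]/((0%:C)%C) (inj_eq (@complexI R)) gt_eqF.
have [|u uE] := @ext_surj R _ _ _ sc (fun q => (ext g q + (eta%:C)%C)^-1).
  move=> q; apply: (@cvgV C _ (nbhs q)); first exact: ge0.
  by apply: (@cvgD C C _ (nbhs q)); [exact: continuous_ext|exact: cvg_cst].
exists (f * u * g); first exact: JM.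
move=> q; rewrite !extM /= uE.
have -> : ext f q - ext f q * (ext g q + (eta%:C)%C)^-1 * ext g q =
    ext f q * ((eta / (t q + eta))%:C)%C.
  have -> : ((eta / (t q + eta))%:C)%C = (eta%:C)%C / (ext g q + (eta%:C)%C).
    by rewrite geE rmorphM fmorphV.
  apply: (mulIf (ge0 q)).
  by rewrite mulrBl mulrAC mulfVK// -mulrA mulfVK// mulrDr addrAC subrr add0r.
rewrite normcM normc_real ger0_norm; last by rewrite divr_ge0// ltW.
(* On [K] the error is at most M eta / (t + eta) = eps / (t + eta), with t > 1. Off [K] the factor
   eta / (t + eta) is at most 1 and |f| < eps. *)
have [Kq|] := leP eps (normc (ext f q)).
  rewrite (le_trans (ler_wpM2r _ (fM q)))//; first by rewrite divr_ge0// ltW.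
  rewrite mulrCA mulrA ler_pdivrMr// divfK ?gt_eqF//.
  apply: ler_peMr; first exact: ltW.
  apply: (@le_trans _ _ (t q)); last by rewrite lerDl ltW.
  by rewrite ltW// -ltcR -gE; exact: gK.
move=> /ltW feps; apply: le_trans feps; rewrite ler_piMr ?sqrtr_ge0//.
  by case: (ext f q) => *; exact: sqrtr_ge0.
by rewrite ler_pdivrMr// mul1r lerDr.
Qed.

(** The cozero sets of two non-zero independent summands would be disjoint nonempty open sets
    covering [U]. *)
Lemma indecomposable_van U : connected U -> open U -> indecomposable (van U).
Proof.
move=> cU oU M N iM iN M0 N0 MN [indMN UMN].
have iMN b : ideal (MN b) by case: b.
have UE : U = coz M `|` coz N.
  rewrite -(coz_van R sc oU) UMN coz_dsum; apply/seteqP; split=> p.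
    by move=> [[] _ ?]; [left|right].
  by move=> [?|?]; [exists true|exists false].
have MN0 : coz M `&` coz N = set0.
  exact: (@coz_independent _ _ _ _ sc _ MN true false iMN indMN).
have MU : coz M = U.
  apply: cU; first exact: coz_neq0.
    exists (coz M); first exact: open_coz.
    by rewrite UE setUK.
  exists (~` coz N); first exact/open_closedC/open_coz.
  by rewrite UE setIUl setICr setU0 -setDE; apply/esym/setDidl.
have [p Np] := coz_neq0 sc iN N0.
have : (coz M `&` coz N) p by split=> //; rewrite MU UE; right.
by rewrite MN0.
Qed.

(** A proper nonempty clopen part [B] of [coz J], with complement [B'], would split [J] as the
    direct sum of [van B] and [van B']. *)
Lemma connected_coz J : ideal J -> closed J -> indecomposable J ->
  connected (coz J).
Proof.
move=> iJ cJ indJ B B0 [C1 oC1 BC1] [C2 cC2 BC2]; apply: contrapT => BJ.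
have oJ : open (coz J) by exact: open_coz.
pose B' := coz J `&` ~` C2.
have oB : open B by rewrite BC1; exact: openI.
have oB' : open B' by apply: openI => //; exact: closed_openC.
have UB : coz J `<=` B `|` B'.
  move=> p Jp; have [C2p|nC2p] := pselect (C2 p); last by right.
  by left; rewrite BC2.
have BB'0 : B `&` B' = set0.
  by apply/seteqP; split=> // p; rewrite {1}BC2 => -[[_ ?] [_]].
have B'0 : B' !=set0.
  apply: contrapT => B'0; apply: BJ; apply/seteqP; split=> [p|p /UB[//|B'p]].
    by rewrite BC2 => -[].
  by exfalso; apply: B'0; exists p.
(* Here closedness of [J] enters: both candidate summands lie in [J]. *)
have vanJ V : V `<=` coz J -> van V `<=` J.
  move=> VJ; rewrite [X in _ `<=` X](closure_id _).1//.
  exact: subset_trans (vanS VJ) (van_coz iJ).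
have BsubJ : B `<=` coz J by rewrite BC1 => p [].
have B'subJ : B' `<=` coz J by move=> p [].
apply: (indJ (van B) (van B')); try exact: ideal_van; try exact: van_neq0.
set K := fun b : bool => _.
split.
  (* With two members, the ideal generated by the others is contained in the single other member. *)
  move=> b; have bK : \bigcup_(j in [set j | j <> b]) K j `<=` K (~~ b).
    by move=> f [[] /= jb Kf]; case: b jb => jb.
  have K0 : K b `&` K (~~ b) = [set 0].
    by case: (b); rewrite /K /= ?[van B' `&` _]setIC; exact: van_disjoint.
  have iK c : ideal (K c) by case: c; exact: ideal_van.
  apply/seteqP; split=> [f [Kf Gf]|_ ->].
    by rewrite -K0; split=> //; exact: (ideal_gen_min (iK _) bK).
  split; first by have [] := iK b.
  by have [] := ideal_ideal_gen (\bigcup_(j in [set j | j <> b]) K j).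
apply/seteqP; split=> [f Jf|]; last first.
  by apply: ideal_gen_min => // f [[] _]; exact: vanJ.
have f0 p : ~ B p -> ~ B' p -> ext f p = 0.
  by move=> Bp B'p; apply: (sub_van_coz Jf) => /UB[].
(* The truncation of [f] to [B]. It agrees with [ext f] on [B] and is 0 on [B'], both open; at any
   remaining point [ext f] vanishes and |G| <= |ext f| gives continuity. *)
pose G p : C := if p \in B then ext f p else 0.
have cG : continuous G.
  move=> p; have [Bp|nBp] := pselect (B p).
    apply: (@cvg_trans _ (ext f q @[q --> p])).
      apply: near_eq_cvg; near=> q; rewrite /G mem_set//.
      by near: q; exact: open_nbhs_nbhs.
    by rewrite /G mem_set//; exact: continuous_ext.
  have Gp : G p = 0 by rewrite /G memNset.
  suff : G q @[q --> p] --> (0 : C) by rewrite -Gp.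
  have [B'p|nB'p] := pselect (B' p).
    apply: cvg_near_cst; near=> q; rewrite /G memNset// => Bq.
    have : (B `&` B') q by split=> //; near: q; exact: open_nbhs_nbhs.
    by rewrite BB'0.
  apply/(@cvgrPdist_lt _ C bX (nbhs p)) => eps eps0.
  have : \forall q \near p, `|0 - ext f q| < eps.
    apply: (@cvgr_dist_lt _ C bX (nbhs p)) => //.
    by rewrite -(f0 p)//; exact: continuous_ext.
  by apply: filterS => q; rewrite /G; case: ifP => // _ _; rewrite subrr normr0.
have [g gE] := ext_surj sc cG.
have -> : f = g + (f - g) by rewrite addrC subrK.
have [_ KD _] := ideal_ideal_gen (\bigcup_i K i).
apply: KD.
  by apply: (@sub_dsum _ _ K true) => p nBp; rewrite gE /G memNset.
apply: (@sub_dsum _ _ K false) => p nB'p; rewrite extB /= gE /G.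
by case: ifPn => [|/negP nBp]; rewrite ?subrr// subr0 f0// => /mem_set.
Unshelve. all: by end_near. Qed.

End Correspondence.

(** * Components of the spectrum against summands of [H] *)

Theorem theorem3p2p12 (R : realType) (X bX : topologicalType) (e : X -> bX)
    (X_completely_regular : completely_regular_space X)
    (X_hausdorff : hausdorff_space X)
    (e_stone_cech : stone_cech e)
    (H : set (CB R X))
    (H_ideal : ideal H) (H_closed : closed H)
    (H_non_vanishing : non_vanishing H) :
  (forall p, sp e H p ->
     open (connected_component (sp e H) p : set (subspace (sp e H)))) <->
  (exists (I : Type) (K : I -> set (CB R X)),
     [/\ forall i, [/\ ideal (K i), closed (K i) & indecomposable (K i)],
         independent K
       & H = closure (dsum K)]).
Proof.
have spE := sp_coz e_stone_cech H_ideal.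
set S := sp e H in spE *.
have oS : open S by rewrite spE; exact: open_coz.
split=> [oC|[I [K [K_ind indK HK]]]].
  pose comp (D : set bX) := exists2 p, S p & D = connected_component S p.
  (* Indexing by the components themselves, not by their points, lists each one once, as
     independence demands. *)
  pose I := {D : set bX | comp D}.
  pose K (i : I) : set (CB R X) := van e_stone_cech (sval i).
  (* Openness relative to [S] is openness in [bX], because [S] is open. *)
  have Iopen (i : I) : open (sval i).
    case: i => /= _ [p Sp ->].
    have /open_subspaceP[V oV] := oC p Sp.
    rewrite [RHS]setIidl; last exact: connected_component_sub.
    by move=> <-; exact: openI.
  have Isub (i : I) : sval i `<=` S.
    by case: i => /= _ [p Sp ->]; exact: connected_component_sub.
  have Idisj (i j : I) p : sval i p -> sval j p -> i = j.
    move=> ip jp.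
    apply: eq_sig_hprop; first by move=> *; exact: Prop_irrelevance.
    case: i ip => /= _ [a Sa ->] ap; case: j jp => /= _ [b Sb ->] bp.
    by rewrite (same_connected_component ap) (same_connected_component bp).
  exists I, K; split.
  - move=> i; split; [exact: ideal_van|exact: closed_van|].
    apply: indecomposable_van; last exact: Iopen.
    by case: i => /= _ [p Sp ->]; exact: component_connected.
  - move=> i.
    (* Components are disjoint, so everything generated by the other members vanishes on the
       component [i]. *)
    have sub : ideal_gen (\bigcup_(j in [set j | j <> i]) K j) `<=`
        van e_stone_cech (~` sval i).
      apply: ideal_gen_min; first exact: ideal_van.
      move=> f [j /= ji Kf]; apply: vanS Kf => p jp ip.
      by apply: ji; exact: Idisj jp ip.
    apply/seteqP; split=> [f [Kf /sub Gf]|_ ->].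
      by rewrite -(van_disjoint R e_stone_cech (setICr (sval i))).
    split; first by have [] := ideal_van R e_stone_cech (sval i).
    by have [] := ideal_ideal_gen (\bigcup_(j in [set j | j <> i]) K j).
  - have SE : S = coz e_stone_cech (dsum K).
      rewrite coz_dsum; apply/seteqP; split=> [p Sp|p [i _]].
        have Ip : comp (connected_component S p) by exists p.
        exists (exist comp _ Ip) => //; rewrite coz_van; last exact: Iopen.
        exact: connected_component_refl.
      by rewrite coz_van => // /Isub.
    (* [H] and the sum share the cozero set [S]: [van_coz] puts [H] in the closure of the sum, and
       each [K i] in the closure of [H], which is [H]. *)
    apply/seteqP; split=> [f Hf|].
      have iD : ideal (dsum K) by exact: ideal_ideal_gen.
      apply: (@van_coz _ _ _ _ e_stone_cech _ iD f).
      by rewrite -SE spE; exact: sub_van_coz.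
    rewrite [X in _ `<=` X](closure_id _).1//; apply: closureS.
    apply: ideal_gen_min => // f [i _ Kf].
    rewrite [H](closure_id _).1//.
    apply: (@van_coz _ _ _ _ e_stone_cech _ H_ideal f).
    by rewrite -spE; apply: vanS Kf; exact: Isub.
have iK i : ideal (K i) by have [] := K_ind i.
pose U i := coz e_stone_cech (K i).
have SE : S = \bigcup_i U i by rewrite spE HK coz_closure coz_dsum.
move=> p; rewrite SE => -[i _ Uip]; rewrite -SE.
apply: open_subspaceW.
suff -> : connected_component S p = U i by exact: open_coz.
apply/seteqP; split; last first.
  apply: connected_component_max => //; first by rewrite SE; exact: bigcup_sup.
  by have [? ? ?] := K_ind i; exact: connected_coz.
have Sp : S p by rewrite SE; exists i.
(* The trace of [U i] on the connected component is nonempty and open; it is also closed, as its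
   complement there is covered by the other, disjoint [U j]. Hence it is the whole component. *)
apply/setIidPl; apply: (@component_connected _ S p).
- by exists p; split=> //; exact: connected_component_refl.
- by exists (U i) => //; exact: open_coz.
- exists (~` \bigcup_(j in [set j | j <> i]) U j).
    by apply/open_closedC/bigcup_open => j _; exact: open_coz.
  apply/seteqP; split=> q [cq].
    move=> Uiq; split=> // -[j /= ji Ujq].
    have : (U j `&` U i) q by [].
    by rewrite /U (coz_independent e_stone_cech iK indK ji).
  move=> nq; split=> //; have := connected_component_sub cq.
  rewrite SE => -[j _ Ujq]; have [<-//|ji] := pselect (j = i).
  by exfalso; apply: nq; exists j.
Qed.
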